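(* Let $C=e^{-2\sqrt{\log 2}}$ and, for integers $L\geq 0$, let $m_L=2\int_0^1 x^L\,\mathrm{d}F(x)$. Then there exist absolute constants $c_1,c_2>0$ such that for all sufficiently large $L$, $$c_1\, C^{\sqrt{L}}\leq m_L\leq c_2\, L^{1/4}\,C^{\sqrt{L}}.$$
   Context: $F:[0,\infty)\to[0,1)$ is the Minkowski question mark function: if $x\geq 0$ has regular continued fraction expansion $x=[a_0;a_1,a_2,\dots]$ ($a_0\in\mathbb{Z}_{\ge0}$, $a_i\in\mathbb{N}$ for $i\ge1$), then $F(x)=1-2^{-a_0}+2^{-(a_0+a_1)}-2^{-(a_0+a_1+a_2)}+\cdots$, the series terminating for rational $x$. It is continuous and non-decreasing, $F(0)=0$, $F(1)=1/2$. Equivalently $m_L=\int_0^\infty \left(\frac{x}{x+1}\right)^L\mathrm{d}F(x)$. *)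

(* Defs.v *)
From HB Require Import structures.
From mathcomp Require Import all_boot all_order all_algebra.
From mathcomp Require Import all_classical all_reals all_analysis.
From mathcomp Require Import ring lra.

Set Implicit Arguments.
Unset Strict Implicit.
Unset Printing Implicit Defensive.

Import Order.TTheory GRing.Theory Num.Theory.
Import numFieldNormedType.Exports.
Local Open Scope classical_set_scope.
Local Open Scope ring_scope.

Section question_mark.
Variable R : realType.
Implicit Types (x y t : R) (n : nat).

Definition cf_frac x : R := x - (Num.truncn x)%:R.

(* Complete quotients of the regular continued fraction of x >= 0.  Since
   0^-1 = 0, once some complete quotient is an integer all the later ones
   are 0. *)
Definition cf_quot x n : R := iter n (fun y => (cf_frac y)^-1) x.

Definition cf_digit x n : nat := Num.truncn (cf_quot x n).

(* Whether a_n occurs in the expansion x = [a_0; a_1, a_2, ...] : digits of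
   positive index are positive, and a digit 0 at such an index means that the
   expansion has already stopped. *)
Definition cf_has_digit x n : bool := (n == 0%N) || (0 < cf_digit x n)%N.

Definition question_mark_term x n : R :=
  if cf_has_digit x n
  then (-1) ^+ n.+1 * 2 ^- (\sum_(k < n.+1) cf_digit x k)%N else 0.

(* Minkowski's question mark function on [0, +oo[, normalised by F(1) = 1/2
   and F(+oo) = 1, and extended by 0 to the negative half-line. *)
Definition question_mark x : R :=
  if 0 <= x then 1 + limn (series (question_mark_term x)) else 0.

Local Notation F := question_mark.
Local Notation term := question_mark_term.

Lemma cf_frac_ge0 x : 0 <= x -> 0 <= cf_frac x.
Proof. by move=> x0; rewrite subr_ge0 truncn_le. Qed.

Lemma cf_frac_lt1 x : cf_frac x < 1.
Proof.
by rewrite /cf_frac ltrBlDr addrC natr1 truncnS_gt.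
Qed.

Lemma cf_frac_inv_gt1 x : 0 <= x -> cf_frac x != 0 -> 1 < (cf_frac x)^-1.
Proof.
move=> x0 fx; rewrite invf_gt1 ?cf_frac_lt1// lt_neqAle eq_sym fx.
exact: cf_frac_ge0.
Qed.

Lemma cf_quotS x n : cf_quot x n.+1 = cf_quot (cf_frac x)^-1 n.
Proof. by rewrite /cf_quot iterSr. Qed.

Lemma cf_quot0 n : cf_quot 0 n = 0.
Proof. by elim: n => [//|n IH]; rewrite cf_quotS /cf_frac truncn0 subr0 invr0. Qed.

Lemma question_mark_term0 x : term x 0 = - 2 ^- Num.truncn x.
Proof. by rewrite /term /cf_has_digit /= big_ord1 expr1 mulN1r. Qed.

Lemma question_mark_termS x n : 0 <= x -> term x n.+1 =
  if cf_frac x == 0 then 0 else - 2 ^- Num.truncn x * term (cf_frac x)^-1 n.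
Proof.
move=> x0; have qS k : cf_digit x k.+1 = cf_digit (cf_frac x)^-1 k.
  by rewrite /cf_digit cf_quotS.
rewrite /term /cf_has_digit qS orFb; case: (eqVneq (cf_frac x) 0) => [->|fx].
  by rewrite invr0 /cf_digit cf_quot0 truncn0.
have d0 : (0 < cf_digit (cf_frac x)^-1 0)%N.
  by rewrite truncn_gt0 (ltW (cf_frac_inv_gt1 x0 fx)).
have -> : (n == 0%N) || (0 < cf_digit (cf_frac x)^-1 n)%N =
    (0 < cf_digit (cf_frac x)^-1 n)%N by case: n => [|//]; rewrite d0.
case: ifPn => _; last by rewrite mulr0.
rewrite big_ord_recl exprD [in LHS]exprS invfM.
under eq_bigr do rewrite qS.
by rewrite mulN1r mulNr mulrCA mulNr.
Qed.

Lemma two_truncn_gt0 x : 0 < 2 ^- Num.truncn x :> R.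
Proof. by rewrite invr_gt0 exprn_gt0. Qed.

Lemma two_truncn_le1 x : 2 ^- Num.truncn x <= 1 :> R.
Proof. by rewrite invf_le1 ?exprn_gt0// exprn_ege1// ler1n. Qed.

Lemma two_truncn_le2 x : 1 <= x -> 2 ^- Num.truncn x <= 2^-1 :> R.
Proof.
move=> x1; rewrite lef_pV2 ?posrE ?exprn_gt0//.
by rewrite -[leLHS]expr1 ler_weXn2l ?ler1n// truncn_gt0.
Qed.

Lemma question_mark_term_le x n : 0 <= x -> `|term x n| <= 2 ^- Num.truncn x * 2 ^- n.
Proof.
elim: n x => [|n IH] x x0.
  by rewrite question_mark_term0 normrN gtr0_norm ?two_truncn_gt0// expr0 invr1 mulr1.
have p := two_truncn_gt0 x.
have q : 0 < 2 ^- n :> R by rewrite invr_gt0 exprn_gt0.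
rewrite question_mark_termS//; case: ifPn => fx.
  by rewrite normr0 mulr_ge0 ?ltW// invr_gt0 exprn_gt0.
rewrite normrM normrN (gtr0_norm p) ler_pM2l//.
have y1 := ltW (cf_frac_inv_gt1 x0 fx).
apply: (le_trans (IH _ (le_trans ler01 y1))).
rewrite exprS invfM ler_pM2r//; exact: two_truncn_le2.
Qed.

Lemma is_cvg_question_mark x : 0 <= x -> cvgn (series (term x)).
Proof.
move=> x0; apply: normed_cvg.
apply: (@series_le_cvg _ _ (geometric 1 2^-1)) => [n|n|n|].
- exact: normr_ge0.
- by rewrite geometric_ge0.
- rewrite /= mul1r exprVn; apply: (le_trans (question_mark_term_le n x0)).
  by rewrite ler_piMl ?two_truncn_le1// invr_ge0 exprn_ge0.
- by apply: is_cvg_geometric_series; rewrite ger0_norm ?invf_lt1// ltr1n.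
Qed.

Lemma question_markE x : 0 <= x -> F x =
  1 - 2 ^- Num.truncn x * (if cf_frac x == 0 then 1 else F (cf_frac x)^-1).
Proof.
move=> x0; rewrite {1}/question_mark x0.
set a : R := 2 ^- _.
have step N : series (term x) N.+1 = - a +
    (if cf_frac x == 0 then 0 else - a * series (term (cf_frac x)^-1) N).
  rewrite /series /= big_nat_recl// question_mark_term0 -/a; congr (_ + _).
  under eq_bigr do rewrite question_mark_termS//.
  case: ifPn => fx; first by rewrite big1.
  by rewrite mulr_sumr.
have cv : series (term x) @ \oo --> - a +
    (if cf_frac x == 0 then 0 else - a * limn (series (term (cf_frac x)^-1))).
  rewrite -cvg_shiftS /=; under eq_fun do rewrite step.
  apply: cvgD; first exact: cvg_cst.
  case: ifPn => fx; first exact: cvg_cst.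
  apply: cvgM; first exact: cvg_cst.
  apply: is_cvg_question_mark.
  by apply: ltW; apply: lt_trans ltr01 (cf_frac_inv_gt1 x0 fx).
rewrite (cvg_lim _ cv)//; case: ifPn => fx; first by rewrite addr0 mulr1.
rewrite /question_mark ifT; last first.
  by apply: ltW; apply: lt_trans ltr01 (cf_frac_inv_gt1 x0 fx).
by rewrite mulrDr mulr1 opprD mulNr.
Qed.

Lemma question_mark_partial N x : 0 <= x -> 0 <= 1 + series (term x) N <= 1.
Proof.
elim: N x => [|N IH] x x0.
  by rewrite /series /= big_geq// addr0 ler01 lexx.
have a0 := two_truncn_gt0 x; have a1 := two_truncn_le1 x.
rewrite /series /= big_nat_recl// question_mark_term0.
rewrite (eq_bigr _ (fun i _ => question_mark_termS i x0)).
case: (eqVneq (cf_frac x) 0) => fx; first by rewrite big1// addr0; lra.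
rewrite -mulr_sumr.
have y0 : 0 <= (cf_frac x)^-1 by rewrite invr_ge0 cf_frac_ge0.
have := IH _ y0; rewrite /series /=; set s := \sum_(0 <= k < N) _.
by move=> /andP[s0 s1]; apply/andP; split; nra.
Qed.

Lemma question_mark_ge0_le1 x : 0 <= F x <= 1.
Proof.
rewrite /question_mark; case: ifPn => x0; last by rewrite lexx ler01.
have cv := is_cvg_question_mark x0.
have cv1 : 1 + series (term x) n @[n --> \oo] --> 1 + limn (series (term x)).
  by apply: cvgD => //; exact: cvg_cst.
rewrite -(cvg_lim _ cv1)//; have cv2 := cvgP _ cv1.
by apply/andP; split; [apply: limr_ge|apply: limr_le] => //; near=> n;
  have /andP[] := question_mark_partial n x0.
Unshelve. all: by end_near. Qed.

Lemma question_mark_half x : 1 <= x -> 2^-1 <= F x.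
Proof.
move=> x1; have x0 := le_trans ler01 x1; rewrite question_markE//.
have := two_truncn_le2 x1; have := two_truncn_gt0 x.
have /andP[] := question_mark_ge0_le1 (cf_frac x)^-1.
by case: ifPn => _; nra.
Qed.

Lemma question_mark_lt1 x : F x < 1.
Proof.
have [x0|x0] := leP 0 x; last by rewrite /question_mark ifN -?ltNge.
rewrite question_markE//; have a0 := two_truncn_gt0 x.
case: ifPn => fx; first by rewrite mulr1; lra.
have := question_mark_half (ltW (cf_frac_inv_gt1 x0 fx)); nra.
Qed.

Lemma question_mark_ge_trunc x : 0 <= x -> 1 - 2 ^- Num.truncn x <= F x.
Proof.
move=> x0; rewrite question_markE//; have := two_truncn_gt0 x.
have /andP[] := question_mark_ge0_le1 (cf_frac x)^-1.
by case: ifPn => _; nra.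
Qed.

Lemma question_mark_le_trunc x : 0 <= x -> F x <= 1 - 2 ^- (Num.truncn x).+1.
Proof.
move=> x0; rewrite question_markE// exprS invfM; have := two_truncn_gt0 x.
case: ifPn => fx; first by nra.
have := question_mark_half (ltW (cf_frac_inv_gt1 x0 fx)); nra.
Qed.

Lemma question_mark_approx_nd n x y : 0 <= x -> x <= y ->
  F x - F y <= 2 ^- n * 2 ^- Num.truncn x.
Proof.
elim: n x y => [|n IH] x y x0 xy; have y0 := le_trans x0 xy;
  have tle := le_truncn xy.
  have : 2 ^- Num.truncn y <= 2 ^- Num.truncn x :> R.
    by rewrite lef_pV2 ?posrE ?exprn_gt0// ler_weXn2l// ler1n.
  rewrite expr0 invr1 mul1r.
  have := question_mark_ge_trunc y0; have := question_mark_lt1 x; lra.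
have q0 : 0 < 2 ^- n.+1 :> R by rewrite invr_gt0 exprn_gt0.
have a0 := two_truncn_gt0 x.
have qa0 : 0 <= 2 ^- n.+1 * 2 ^- Num.truncn x :> R by rewrite mulr_ge0// ltW.
move: tle; rewrite leq_eqVlt => /orP[/eqP txy|txy]; last first.
  have : 2 ^- Num.truncn y <= 2 ^- (Num.truncn x).+1 :> R.
    by rewrite lef_pV2 ?posrE ?exprn_gt0// ler_weXn2l// ler1n.
  have := question_mark_ge_trunc y0; have := question_mark_le_trunc x0; lra.
have := question_mark_ge_trunc y0; rewrite -txy => Fy.
have [fx|fx] := eqVneq (cf_frac x) 0.
  by rewrite (question_markE x0) fx eqxx mulr1; lra.
have fx0 : 0 < cf_frac x by rewrite lt_neqAle eq_sym fx cf_frac_ge0.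
have fxy : cf_frac x <= cf_frac y by rewrite /cf_frac txy lerB.
have fy0 := lt_le_trans fx0 fxy.
have fy : cf_frac y != 0 by rewrite gt_eqF.
rewrite (question_markE x0) (question_markE y0) -txy (negbTE fx) (negbTE fy).
have y1 := cf_frac_inv_gt1 y0 fy.
have yx : (cf_frac y)^-1 <= (cf_frac x)^-1 by rewrite lef_pV2.
have h := IH _ _ (le_trans ler01 (ltW y1)) yx.
have h2 := two_truncn_le2 (ltW y1).
have : F (cf_frac y)^-1 - F (cf_frac x)^-1 <= 2 ^- n.+1.
  apply: (le_trans h); rewrite exprSr invfM ler_wpM2l// invr_ge0 exprn_ge0.
nra.
Qed.

Lemma half_expn_lt (e : R) : 0 < e -> exists n, 2 ^- n < e.
Proof.
move=> e0; exists (Num.truncn e^-1).+1.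
rewrite invf_plt ?posrE ?exprn_gt0//; apply: (lt_trans (truncnS_gt _)).
by rewrite -natrX ltr_nat ltn_expl.
Qed.

Lemma question_mark_nd : nondecreasing F.
Proof.
move=> x y xy; have [x0|x0] := leP 0 x; last first.
  rewrite {1}/question_mark ifN -?ltNge//.
  by have /andP[] := question_mark_ge0_le1 y.
rewrite leNgt; apply/negP; rewrite -subr_gt0 => /half_expn_lt[n].
apply/negP; rewrite -leNgt; apply: (le_trans (question_mark_approx_nd n x0 xy)).
by rewrite ler_piMr ?two_truncn_le1// invr_ge0 exprn_ge0.
Qed.

Lemma cf_frac_nat m : cf_frac m%:R = 0.
Proof. by rewrite /cf_frac natrK subrr. Qed.

Lemma question_mark_nat m : F m%:R = 1 - 2 ^- m.
Proof. by rewrite question_markE// cf_frac_nat eqxx mulr1 natrK. Qed.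

Lemma question_markD1 x : 0 <= x -> F (x + 1) = (1 + F x) / 2.
Proof.
move=> x0; have t1 : Num.truncn (x + 1) = (Num.truncn x).+1.
  apply: truncn_def; rewrite -!natr1 lerD2r ltrD2r.
  by rewrite truncn_le x0 natr1 truncnS_gt.
have f1 : cf_frac (x + 1) = cf_frac x by rewrite /cf_frac t1 -natr1; ring.
rewrite question_markE ?addr_ge0// f1 t1 (question_markE x0) exprS invfM.
by field; rewrite expf_neq0.
Qed.

Lemma question_markV x : 1 <= x -> F x^-1 = 1 - F x.
Proof.
rewrite le_eqVlt => /predU1P[<-|x1].
  by rewrite invr1 (question_mark_nat 1) expr1; field.
have x0 := lt_trans ltr01 x1.
have t0 : Num.truncn x^-1 = 0%N.
  by apply: truncn_def; rewrite invr_ge0 (ltW x0) invf_lt1.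
have f0 : cf_frac x^-1 = x^-1 by rewrite /cf_frac t0 subr0.
rewrite question_markE ?invr_ge0 ?(ltW x0)// f0 t0 invr_eq0 gt_eqF// invrK.
by rewrite expr0 invr1 mul1r.
Qed.

Lemma question_mark_dense n t : 0 <= t < 1 ->
  exists2 x, 0 <= x & `|F x - t| <= 2 ^- n.
Proof.
elim: n t => [|n IH] t /andP[t0 t1].
  exists 0 => //; rewrite (question_mark_nat 0) expr0 invr1 subrr sub0r normrN.
  by rewrite ger0_norm// ltW.
have dn (s : R) : 2^-1 <= s < 1 -> exists2 x, 1 <= x & `|F x - s| <= 2 ^- n.+1.
  move=> /andP[s0 s1]; have [|x x0 xs] := IH (2 * s - 1).
    by apply/andP; split; lra.
  exists (x + 1); first by rewrite lerDr.
  rewrite question_markD1// (_ : _ - s = 2^-1 * (F x - (2 * s - 1))); last by field.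
  rewrite normrM gtr0_norm ?invr_gt0// exprS invfM ler_pM2l// invr_gt0//.
have [st|ts] := leP 2^-1 t.
  by have [|x x1 xt] := dn t; [rewrite st|exists x => //; exact: le_trans ler01 x1].
have [->|tn0] := eqVneq t 0.
  exists 0 => //; rewrite (question_mark_nat 0) expr0 invr1 !subrr normr0.
  by rewrite invr_ge0 exprn_ge0.
have tp : 0 < t by rewrite lt_neqAle eq_sym tn0.
have [|x x1 xt] := dn (1 - t); first by apply/andP; split; lra.
exists x^-1; first by rewrite invr_ge0 (le_trans ler01 x1).
rewrite question_markV// (_ : 1 - F x - t = - (F x - (1 - t))) ?normrN//.
by ring.
Qed.

Lemma question_mark_rc : right_continuous F.
Proof.
move=> x; have [x0|x0] := ltP x 0.
  have -> : F x = 0 by rewrite /question_mark ifN -?ltNge.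
  apply: (@cvg_trans _ ((fun=> 0 : R) @ at_right x)); last exact: cvg_cst.
  apply: near_eq_cvg; near=> y; rewrite /question_mark ifN// -ltNge.
  by near: y; exact: nbhs_right_lt.
have /andP[Fx0 _] := question_mark_ge0_le1 x.
have Fx1 := question_mark_lt1 x.
apply/cvgrPdist_le => e e0.
pose d := Order.min e (1 - F x).
have d0 : 0 < d by rewrite lt_min e0 subr_gt0.
have de : d <= e by rewrite ge_min lexx.
have d1 : d <= 1 - F x by rewrite ge_min lexx orbT.
have [n nd] := half_expn_lt (divr_gt0 d0 (ltr0n _ 2)).
have [|z z0] := @question_mark_dense n (F x + d / 2).
  by apply/andP; split; lra.
rewrite ler_norml => /andP[zl zr].
have xz : x < z.
  by rewrite ltNge; apply/negP => /question_mark_nd; lra.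
near=> y.
have xy : x < y by near: y; exact: nbhs_right_gt.
have yz : y < z by near: y; exact: nbhs_right_lt.
have := question_mark_nd (ltW xy); have := question_mark_nd (ltW yz).
by move=> h1 h2; rewrite ler0_norm; lra.
Unshelve. all: by end_near. Qed.

HB.instance Definition _ :=
  isCumulative.Build R _ R F question_mark_nd question_mark_rc.

Definition question_mark_moment (L : nat) : R :=
  2 * \int[lebesgue_stieltjes_measure F]_(x in `[0, 1]) x ^+ L.

End question_mark.

(* Main.v *)
(* The nodes k / (k + 1) cut [0, 1] into pieces of dF-mass 2^-(k+2), because
   F(k / (k + 1)) = F(k) / 2.  Hence m_L is comparable, up to constants, to
   sum_t 2^-t (1 - 1/t)^L, and (1 - 1/t)^L is about exp(- L / t).  With
   b^2 = ln 2 and s = sqrt L,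
     b^2 t + s^2 / t = 2 b s + (s - b t)^2 / t,
   so every term is at most exp(- 2 b s) = C^s, and the term with t close to
   s / b attains it up to a constant: this is the lower bound.  Above
   t = 2 s / b the total mass 2^-t is already at most C^s; below it,
   (s - b t)^2 / t dominates a multiple of (|t - s / b| / sqrt s)^2, so that
   the terms decay geometrically at rate 1 / sqrt s on both sides of s / b and
   sum to O(sqrt s) C^s = O(L^(1/4)) C^s. *)
Require Import Defs.
From HB Require Import structures.
From mathcomp Require Import all_boot all_order all_algebra.
From mathcomp Require Import all_classical all_reals all_analysis.
From mathcomp Require Import measurable_realfun.
From mathcomp Require Import ring lra.

Set Implicit Arguments.
Unset Strict Implicit.
Unset Printing Implicit Defensive.

Import Order.TTheory GRing.Theory Num.Theory.
Import numFieldNormedType.Exports.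
Local Open Scope classical_set_scope.
Local Open Scope ring_scope.

(** * Integrals of powers against a Stieltjes measure *)

Section stieltjes_power.
Variables (R : realType) (f : cumulative R R) (L : nat).
Local Notation mu := (lebesgue_stieltjes_measure f).

Lemma lebesgue_stieltjes_itv_oc (a b : R) : a <= b ->
  mu `]a, b] = (f b - f a)%:E.
Proof.
move=> ab; rewrite /lebesgue_stieltjes_measure /measure_extension.
by rewrite measurable_mu_extE/= ?wlength_itv_bnd//; exact: is_ocitv.
Qed.

Let measurable_power (D : set (measurableTypeR R)) :
  measurable_fun D (fun x : R => (x ^+ L)%:E).
Proof. by apply/measurable_EFinP; exact: exprn_measurable. Qed.

Lemma integral_power_itv_oc (a b : R) : 0 <= a -> a <= b ->
  ((a ^+ L * (f b - f a))%:E <= \int[mu]_(x in `]a, b]) (x ^+ L)%:E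
    <= (b ^+ L * (f b - f a))%:E)%E.
Proof.
move=> a0 ab; have m : measurable (`]a, b] : set (measurableTypeR R)).
  exact: measurable_itv.
rewrite 2!EFinM -lebesgue_stieltjes_itv_oc//.
apply/andP; split; rewrite -integral_cst//; apply: ge0_le_integral => //=.
- by move=> x _; rewrite lee_fin exprn_ge0.
- move=> x; rewrite in_itv/= => /andP[ax _].
  by rewrite lee_fin lerXn2r// ?nnegrE// ?(le_trans a0)// ltW.
- move=> x; rewrite in_itv/= => /andP[ax _].
  by rewrite lee_fin exprn_ge0// (le_trans a0)// ltW.
- move=> x; rewrite in_itv/= => /andP[ax xb].
  have x0 : 0 <= x by rewrite (le_trans a0)// ltW.
  by rewrite lee_fin lerXn2r// ?nnegrE// (le_trans x0).
Qed.

Lemma integral_power_split (a b : R) : 0 <= a -> a <= b ->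
  (\int[mu]_(x in `[0%R, b]) (x ^+ L)%:E =
   \int[mu]_(x in `[0%R, a]) (x ^+ L)%:E + \int[mu]_(x in `]a, b]) (x ^+ L)%:E)%E.
Proof.
move=> a0 ab; rewrite (@itv_bndbnd_setU _ _ _ (BRight a)) ?bnd_simp//.
rewrite ge0_integral_setU//=; try exact: measurable_itv.
- by move=> x [|]; rewrite /= in_itv/= => /andP[x0 _];
    rewrite lee_fin exprn_ge0// ltW// (le_lt_trans a0).
- apply/disj_setPS => x [/=]; rewrite !in_itv/= => /andP[_ xa] /andP[ax _].
  by have := lt_le_trans ax xa; rewrite ltxx.
Qed.

End stieltjes_power.

(** * The moment compared with sums over the nodes [k / (k + 1)] *)

Section moment.
Variable R : realType.
Local Notation F := (@question_mark R).
Local Notation mu := (lebesgue_stieltjes_measure F).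

Definition frac_node (k : nat) : R := k%:R / k.+1%:R.

Lemma frac_nodeE k : frac_node k = 1 - k.+1%:R^-1.
Proof. by rewrite /frac_node -natr1; field; rewrite natr1 pnatr_eq0. Qed.

Lemma frac_node_ge0 k : 0 <= frac_node k.
Proof. by rewrite divr_ge0. Qed.

Lemma frac_node_le1 k : frac_node k <= 1.
Proof. by rewrite frac_nodeE lerBlDr lerDl invr_ge0. Qed.

Lemma frac_node_le k : frac_node k <= frac_node k.+1.
Proof. by rewrite !frac_nodeE lerD2l lerN2 lef_pV2 ?posrE// ler_nat. Qed.

(** For [k > 0] the node is the inverse of [1/k + 1]: reflection, shift and reflection again lead
    back to [F k], halved by the shift. *)
Lemma question_mark_frac_node k : F (frac_node k) = (1 - 2 ^- k) / 2.
Proof.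
case: k => [|k].
  by rewrite /frac_node mul0r (question_mark_nat R 0) expr0 invr1; ring.
have k0 : k.+1%:R != 0 :> R by rewrite pnatr_eq0.
have -> : frac_node k.+1 = (k.+1%:R^-1 + 1)^-1.
  rewrite /frac_node -[k.+2%:R]natr1.
  move: (k.+1%:R) (ltr0Sn R k) => n n0; field.
  by rewrite !gt_eqF ?addr_gt0.
have i0 : 0 <= k.+1%:R^-1 :> R by rewrite invr_ge0.
rewrite question_markV ?lerDr// question_markD1// question_markV ?ler1n//.
by rewrite question_mark_nat; field; rewrite expf_neq0.
Qed.

Let question_mark1 : F 1 = 2^-1.
Proof. by rewrite (question_mark_nat R 1) expr1; field. Qed.

Let mass_node N : F (frac_node N.+1) - F (frac_node N) = 2 ^- N.+2.
Proof.
by rewrite !question_mark_frac_node !exprS; field; rewrite expf_neq0.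
Qed.

Lemma integral_power_node_le N L : (0 < L)%N ->
  (\int[mu]_(x in `[0%R, frac_node N]) (x ^+ L)%:E <=
    (\sum_(k < N) frac_node k.+1 ^+ L * 2 ^- k.+2)%:E)%E.
Proof.
move=> L0; elim: N => [|N IH].
  (* [frac_node 0] is 0, so the domain is the single point 0, where [x ^+ L] vanishes because
     [0 < L]. *)
  rewrite big_ord0 integral0_eq// => x; rewrite /frac_node mul0r /= in_itv/=.
  by rewrite -eq_le => /eqP<-; rewrite expr0n eqn0Ngt L0.
rewrite (@integral_power_split _ _ _ (frac_node N)) ?frac_node_ge0 ?frac_node_le//.
rewrite big_ord_recr/= EFinD leeD// -mass_node.
by have /andP[] :=
  integral_power_itv_oc F L (frac_node_ge0 N) (frac_node_le N).
Qed.

(** Right of [frac_node N] the integrand is at most 1, and the mass left there is [2 ^- N.+1]. *)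
Lemma integral_power_le N L : (0 < L)%N ->
  (\int[mu]_(x in `[0%R, 1%R]) (x ^+ L)%:E <=
    (\sum_(k < N) frac_node k.+1 ^+ L * 2 ^- k.+2 + 2 ^- N.+1)%:E)%E.
Proof.
move=> L0; rewrite (@integral_power_split _ _ _ (frac_node N))
  ?frac_node_ge0 ?frac_node_le1//.
rewrite EFinD; apply: leeD; first exact: integral_power_node_le.
have /andP[_ /le_trans->]// :=
  integral_power_itv_oc F L (frac_node_ge0 N) (frac_node_le1 N).
rewrite lee_fin expr1n mul1r /= question_mark1 question_mark_frac_node exprS.
by rewrite le_eqVlt; apply/orP; left; apply/eqP; field; rewrite expf_neq0.
Qed.

Let integral_power_ge0 (a : R) L :
  (0 <= \int[mu]_(x in `[0%R, a]) (x ^+ L)%:E)%E.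
Proof.
apply: integral_ge0 => x; rewrite /= in_itv/= => /andP[x0 _].
by rewrite lee_fin exprn_ge0.
Qed.

Lemma moment_le N L : (0 < L)%N ->
  question_mark_moment R L <=
    \sum_(k < N) frac_node k.+1 ^+ L * 2 ^- k.+1 + 2 ^- N.
Proof.
move=> L0; have h := integral_power_le N L0.
have : question_mark_moment R L <=
    2 * (\sum_(k < N) frac_node k.+1 ^+ L * 2 ^- k.+2 + 2 ^- N.+1).
  rewrite /question_mark_moment ler_pM2l// -lee_fin fineK//.
  by rewrite ge0_fin_numE ?integral_power_ge0// (le_lt_trans h)// ltry.
move=> /le_trans; apply; rewrite mulrDr mulr_sumr le_eqVlt; apply/orP; left.
apply/eqP; congr (_ + _); last by rewrite exprS; field; rewrite expf_neq0.
by apply: eq_bigr => i _; rewrite !exprS; field; rewrite expf_neq0.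
Qed.

Lemma moment_ge k L : (0 < L)%N ->
  frac_node k ^+ L * 2 ^- k <= question_mark_moment R L.
Proof.
(* This upper bound only shows that the integral is finite, so that it can be compared as a real
   number. *)
move=> L0; have h := integral_power_le 0 L0.
have fi : (\int[mu]_(x in `[0%R, 1%R]) (x ^+ L)%:E)%E \is a fin_num.
  by rewrite ge0_fin_numE ?integral_power_ge0// (le_lt_trans h)// ltry.
have -> : frac_node k ^+ L * 2 ^- k =
    2 * (frac_node k ^+ L * (F 1 - F (frac_node k))).
  rewrite question_mark1 question_mark_frac_node.
  by field; rewrite expf_neq0.
rewrite /question_mark_moment ler_pM2l// -lee_fin fineK//.
rewrite (@integral_power_split _ _ _ (frac_node k)) ?frac_node_ge0 ?frac_node_le1//.
have /andP[/le_trans-> //] :=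
  integral_power_itv_oc F L (frac_node_ge0 k) (frac_node_le1 k).
by rewrite leeDr.
Qed.

End moment.

(** * Geometric sums and exponential estimates *)

Section estimates.
Variable R : realType.

(* With truncated subtraction, (k - m) + (m - k) is the distance |k - m|. *)
Lemma two_sided_geometric_le (q : R) m N : 0 <= q <= 1 ->
  (1 - q) * \sum_(k < N) q ^+ ((k - m) + (m - k))%N <= 2 - q ^+ m.
Proof.
move=> /andP[q0 q1]; elim: m N => [|m IH] [|N].
- by rewrite big_ord0 mulr0 expr0; lra.
- under eq_bigr do rewrite subn0 sub0n addn0.
  rewrite -opprB mulNr -subrX1 expr0.
  by have := exprn_ge0 N.+1 q0; lra.
- by rewrite big_ord0 mulr0 subr_ge0 (le_trans (exprn_ile1 _ q0 q1))// ler1n.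
(* The term [k = 0] is [q ^+ m.+1]; shifting the others moves the centre to [m], and the induction
   closes by [0 <= q ^+ m * (1 - q) ^+ 2]. *)
rewrite big_ord_recl/= sub0n subn0 add0n mulrDr.
under eq_bigr do rewrite /bump/= add1n !subSS.
have := IH N; have := exprn_ge0 m q0; rewrite exprS.
move: (q ^+ m) => y; move: ((1 - q) * _) => S y0 Sle.
have : 0 <= y * (1 - q) ^+ 2 by rewrite mulr_ge0 ?sqr_ge0.
by rewrite expr2; nra.
Qed.

(** From [1 + v <= expR v] the ratio [q] satisfies [q * (1 + v) <= 1], hence
    [1 / (1 - q) <= 1 + 1 / v]. *)
Lemma two_sided_expR_le (v : R) m N : 0 < v ->
  \sum_(k < N) expR (- v) ^+ ((k - m) + (m - k))%N <= 2 * (1 + v^-1).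
Proof.
move=> v0; have v1 : 0 < 1 + v by rewrite addr_gt0.
have q0 := expR_gt0 (- v).
have : expR (- v) <= (1 + v)^-1.
  by rewrite expRN lef_pV2 ?posrE ?expR_gt0// expR_ge1Dx.
move: (expR (- v)) q0 => q q0; rewrite -[_^-1]mul1r ler_pdivlMr// => qv.
have q1 : 0 < 1 - q by rewrite subr_gt0; nra.
have := @two_sided_geometric_le q m N; rewrite ltW// -subr_ge0 ltW// => /(_ isT).
move: (\sum_(_ < _) _) => S Sle.
have S2 : (1 - q) * S <= 2.
  by apply: (le_trans Sle); rewrite lerBlDr lerDl exprn_ge0// ltW.
rewrite (_ : 2 * (1 + v^-1) = 2 * (1 + v) / v); last by field; rewrite gt_eqF.
rewrite ler_pdivlMr//.
have [S0|/ltW S0] := leP S 0; first by nra.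
have : 0 <= S * (1 - q * (1 + v)) by rewrite mulr_ge0// subr_ge0.
nra.
Qed.

Lemma halfX_expR (t : nat) : 2 ^- t = expR (- (ln 2 * t%:R)) :> R.
Proof. by rewrite expRN expRM_natr lnK// posrE. Qed.

Lemma onemV_expn_le (t L : nat) : (0 < t)%N ->
  (1 - t%:R^-1) ^+ L <= expR (- (L%:R / t%:R)) :> R.
Proof.
move=> t0; rewrite -mulrN expRM_natl lerXn2r ?nnegrE ?expR_ge0//.
  by rewrite subr_ge0 invf_le1 ?ltr0n// ler1n.
exact: expR_ge1Dx.
Qed.

(** [1 - 1 / (k + 1)] is the inverse of [1 + 1 / k], which is at most [expR (1 / k)]. *)
Lemma onemV_expn_ge (k L : nat) : (0 < k)%N ->
  expR (- (L%:R / k%:R)) <= (1 - k.+1%:R^-1) ^+ L :> R.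
Proof.
move=> k0; rewrite -mulrN expRM_natl lerXn2r ?nnegrE ?expR_ge0//.
  by rewrite subr_ge0 invf_le1 ?ltr0n// ler1n.
have k0' : 0 < k%:R :> R by rewrite ltr0n.
have -> : 1 - k.+1%:R^-1 = (1 + k%:R^-1)^-1 :> R.
  rewrite -natr1; field.
  by rewrite !gt_eqF//= ?addr_gt0.
by rewrite expRN lef_pV2 ?posrE ?expR_gt0 ?addr_gt0 ?invr_gt0// expR_ge1Dx.
Qed.

(** Rounding the real centre [y] to a natural number, as the two-sided geometric sum requires, costs
    at most 1 in the distance. *)
Lemma distn_truncn_le (y : R) (k : nat) : 0 <= y ->
  ((k - Num.truncn y) + (Num.truncn y - k))%:R <= `|k%:R - y| + 1.
Proof.
move=> y0; have /andP[] := truncn_itv y0; rewrite -natr1.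
move: (Num.truncn y) => m my ym; have [km|/ltnW mk] := leqP k m.
  move/eqP: (km) => ->; rewrite add0n natrB//.
  have := ler_norm (y - k%:R); rewrite distrC; lra.
move/eqP: (mk) => ->; rewrite addn0 natrB//.
by have := ler_norm (k%:R - y); lra.
Qed.

(** Completing the square leaves [b^2 (t - r^2 / b)^2 / t], and [b t <= 3 r^2] bounds [1 / t] below
    by [b / (3 r^2)]. Here [r] stands for the fourth root of [L]. *)
Lemma exponent_ge (b r t : R) : 0 < b -> 0 < r -> 0 < t ->
  b * t <= 3 * r ^+ 2 ->
  2 * b * r ^+ 2 + b ^+ 3 / 3 * (2 * `|t - r ^+ 2 / b| / r - 1) <=
  b ^+ 2 * t + r ^+ 4 / t.
Proof.
move=> b0 r0 t0 tle; have [bn rn tn] := And3 (gt_eqF b0) (gt_eqF r0) (gt_eqF t0).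
(* The identity 2D - 1 = D^2 - (D - 1)^2 trades a Gaussian for a geometric decay. *)
pose D := `|t - r ^+ 2 / b| / r.
have -> : 2 * `|t - r ^+ 2 / b| / r - 1 = D ^+ 2 - (D - 1) ^+ 2.
  by rewrite /D; ring.
have D2 : D ^+ 2 = (t - r ^+ 2 / b) ^+ 2 / r ^+ 2.
  by rewrite /D expr_div_n real_normK// num_real.
have -> : b ^+ 2 * t + r ^+ 4 / t =
    2 * b * r ^+ 2 + b ^+ 2 * (t - r ^+ 2 / b) ^+ 2 / t.
  by field; rewrite bn tn.
rewrite lerD2l; apply: (@le_trans _ _ (b ^+ 3 / 3 * D ^+ 2)).
  by rewrite ler_wpM2l ?divr_ge0 ?exprn_ge0 ?(ltW b0)// lerBlDr lerDl sqr_ge0.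
have -> : b ^+ 3 / 3 * D ^+ 2 =
    b ^+ 2 * (t - r ^+ 2 / b) ^+ 2 * (b / (3 * r ^+ 2)).
  by rewrite D2; field; rewrite bn rn.
rewrite ler_wpM2l ?(mulr_ge0 (sqr_ge0 _) (sqr_ge0 _))//.
by rewrite ler_pdivrMr ?mulr_gt0 ?exprn_gt0// mulrC ler_pdivlMr.
Qed.

End estimates.

(** * Lower and upper bounds for the moment *)

Section asymptotics.
Variable R : realType.
Let b : R := Num.sqrt (ln 2).
Let c : R := b ^+ 3 / 3.

Let ln2_gt0 : 0 < ln 2 :> R.
Proof. by rewrite ln_gt0 ?ltr1n. Qed.

Let b_gt0 : 0 < b. Proof. by rewrite sqrtr_gt0. Qed.

Let b2 : b ^+ 2 = ln 2. Proof. by rewrite sqr_sqrtr// ltW. Qed.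

Let b_le1 : b <= 1.
Proof.
rewrite -(@ler_pXn2r _ 2)// ?nnegrE ?ler01 ?(ltW b_gt0)// b2 expr1n.
by rewrite (_ : 2 = 1 + 1 :> R)// le_ln1Dx// (lt_trans _ ltr01) ?ltrN10.
Qed.

Let c_gt0 : 0 < c. Proof. by rewrite divr_gt0 ?exprn_gt0. Qed.

Lemma moment_lower L : (0 < L)%N ->
  2^-1 * expR (- (2 * b * Num.sqrt L%:R)) <= question_mark_moment R L.
Proof.
move=> L0; set s : R := Num.sqrt L%:R.
have s0 : 0 < s by rewrite sqrtr_gt0 ltr0n.
have s2 : s ^+ 2 = L%:R by rewrite sqr_sqrtr// ler0n.
have x0 : 0 < s / b by rewrite divr_gt0.
(* Rounding up gives [L / k <= b s], while [k <= s / b + 1] makes [b^2 k] exceed [b s] by at most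
   [b^2 = ln 2]: hence the factor [2^-1]. *)
pose k := (Num.truncn (s / b)).+1.
have /andP[kle klt] := truncn_itv (ltW x0); rewrite -/k in klt.
have k0 : 0 < k%:R :> R by rewrite ltr0n.
apply: (le_trans _ (moment_ge R k L0)).
rewrite frac_nodeE; apply: (le_trans _ (ler_wpM2r _ (onemV_expn_ge R L _))) => //.
rewrite halfX_expR -expRD -b2.
have -> : 2^-1 = expR (- b ^+ 2) :> R by rewrite b2 expRN lnK ?posrE.
rewrite -expRD ler_expR.
have : L%:R / k%:R <= b * s.
  rewrite ler_pdivrMr// -s2 expr2 mulrAC ler_pM2r// mulrC -ler_pdivrMr//.
  exact: ltW.
have : b ^+ 2 * k%:R <= b * s + b ^+ 2.
  rewrite (_ : b * s + _ = b ^+ 2 * (s / b + 1)); last by field; rewrite gt_eqF.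
  by rewrite ler_pM2l ?exprn_gt0// /k -natr1 lerD2r.
lra.
Qed.

(** The term of index [k] has [t = k + 2], so the peak [t = r^2 / b] lies at [k = r^2 / b - 2]. In
    [expR (3 * c)], one [c] comes from the [- 1] in [exponent_ge] and [2 * c] covers rounding the
    centre. *)
Lemma moment_term_le r k L : 2 <= r -> r ^+ 4 = L%:R ->
  k%:R <= 2 * r ^+ 2 / b ->
  frac_node R k.+1 ^+ L * 2 ^- k.+1 <=
  2 * expR (- (2 * b * r ^+ 2)) * expR (3 * c) *
  expR (- (2 * c / r)) ^+ ((k - Num.truncn (r ^+ 2 / b - 2)%R) +
                           (Num.truncn (r ^+ 2 / b - 2)%R - k)).
Proof.
move=> r2 rL kle; have r0 : 0 < r by lra.
have x2 : 2 <= r ^+ 2 / b.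
  by rewrite ler_pdivlMr// expr2; have := b_le1; nra.
have y0 : 0 <= r ^+ 2 / b - 2 by lra.
have := distn_truncn_le k y0; set d := (_ - _ + _)%N => dle.
have t0 : 0 < k.+2%:R :> R by rewrite ltr0n.
have tE : k.+2%:R = k%:R + 2 :> R by rewrite -addn2 natrD.
have tle : b * k.+2%:R <= 3 * r ^+ 2.
  rewrite mulrC -ler_pdivlMr// tE; move: kle x2; rewrite -!mulrA.
  by move: (r ^+ 2 / b) => x; lra.
have := exponent_ge b_gt0 r0 t0 tle; rewrite -/c => h.
rewrite frac_nodeE; apply: (@le_trans _ _
  (2 * expR (- (b ^+ 2 * k.+2%:R + r ^+ 4 / k.+2%:R)))).
  rewrite (_ : 2 * expR _ = expR (- (L%:R / k.+2%:R)) * 2 ^- k.+1).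
    by rewrite ler_pM2r ?invr_gt0 ?exprn_gt0// onemV_expn_le.
  rewrite opprD expRD b2 -halfX_expR rL [2 ^+ k.+2]exprS.
  by field; rewrite expf_neq0.
rewrite -2![leRHS]mulrA ler_pM2l// -expRM_natl -!expRD ler_expR.
set v := 2 * c / r; rewrite -/v in h *.
have vle : v <= 2 * c.
  by rewrite ler_pdivrMr//; have := c_gt0; nra.
have v0 : 0 < v by rewrite divr_gt0// mulr_gt0.
have e : c * (2 * `|k.+2%:R - r ^+ 2 / b| / r - 1) =
    v * `|k%:R - (r ^+ 2 / b - 2)| - c.
  rewrite tE (_ : _ + 2 - _ = k%:R - (r ^+ 2 / b - 2)); last by ring.
  by rewrite /v; field; rewrite !gt_eqF.
move: h; rewrite e => h.
have : v * d%:R <= v * (`|k%:R - (r ^+ 2 / b - 2)| + 1) by rewrite ler_pM2l.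
move: h vle; clearbody v c; move: (b ^+ 2 * _ + _) (2 * b * _) `|_| => p q D.
rewrite mulrDr mulr1 mulrN (mulrC _ v).
by move: (v * D) (v * d%:R) => x y; lra.
Qed.

Lemma moment_upper r L : 2 <= r -> r ^+ 4 = L%:R ->
  question_mark_moment R L <=
  (2 * expR (3 * c) * (2 + c^-1) + 1) * r * expR (- (2 * b * r ^+ 2)).
Proof.
move=> r2 rL; have r0 : 0 < r by lra.
have L0 : (0 < L)%N by rewrite -(ltr0n R) -rL exprn_gt0.
set E := expR (- (2 * b * r ^+ 2)); have E0 : 0 < E by exact: expR_gt0.
have x0 : 0 <= 2 * r ^+ 2 / b by rewrite divr_ge0 ?mulr_ge0 ?sqr_ge0 ?ltW.
(* [N] exceeds [2 r^2 / b], which makes the tail [2 ^- N] at most [E]; yet each [k < N] is still at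
   most [2 r^2 / b], as [moment_term_le] requires. *)
pose N := (Num.truncn (2 * r ^+ 2 / b)).+1.
have /andP[Nle Nlt] := truncn_itv x0; rewrite -/N in Nlt.
have v0 : 0 < 2 * c / r by rewrite divr_gt0// mulr_gt0.
set q := expR (- (2 * c / r)); pose m := Num.truncn (r ^+ 2 / b - 2).
(* The two-sided bound equals [2 + r / c]; this factor [r] becomes [L^(1/4)]. *)
have S : \sum_(k < N) q ^+ ((k - m) + (m - k))%N <= (2 + c^-1) * r.
  apply: (le_trans (two_sided_expR_le m N v0)).
  rewrite (_ : 2 * _ = 2 + c^-1 * r); last by field; rewrite !gt_eqF.
  by rewrite mulrDl lerD2r ler_peMr// (le_trans _ r2)// ler1n.
have T : 2 ^- N <= E :> R.
  rewrite halfX_expR -b2 ler_expR lerN2.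
  rewrite (_ : 2 * b * _ = b ^+ 2 * (2 * r ^+ 2 / b)); last by field; rewrite gt_eqF.
  by rewrite ler_pM2l ?exprn_gt0// ltW.
have e0 := expR_gt0 (3 * c).
apply: (le_trans (moment_le R N L0)).
apply: (@le_trans _ _ (2 * E * expR (3 * c) * ((2 + c^-1) * r) + E)); last first.
  rewrite (_ : _ * r * E = 2 * E * expR (3 * c) * ((2 + c^-1) * r) + r * E).
    by rewrite lerD2l ler_peMl ?ltW// (lt_le_trans _ r2)// ltr1n.
  by move: (expR _) (c^-1) E {E0 T} => x y z; ring.
apply: lerD => //.
apply: (@le_trans _ _ (2 * E * expR (3 * c) *
    \sum_(k < N) q ^+ ((k - m) + (m - k))%N)); last first.
  by rewrite ler_pM2l ?mulr_gt0.
rewrite mulr_sumr; apply: ler_sum => k _; apply: moment_term_le => //.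
by apply: le_trans Nle; rewrite ler_nat -ltnS ltn_ord.
Qed.

End asymptotics.

Theorem theorem3 (R : realType) :
  let C : R := expR (- (2 * Num.sqrt (ln 2))) in
  exists c1 c2 : R, [/\ 0 < c1, 0 < c2 &
    \forall L \near \oo,
      c1 * C `^ Num.sqrt L%:R <= question_mark_moment R L
        <= c2 * L%:R `^ (1 / 4) * C `^ Num.sqrt L%:R].
Proof.
set b := Num.sqrt (ln 2); pose c := b ^+ 3 / 3; rewrite /=.
have c0 : 0 < c by rewrite divr_gt0// exprn_gt0// sqrtr_gt0 ln_gt0// ltr1n.
exists 2^-1, (2 * expR (3 * c) * (2 + c^-1) + 1); split => //.
  by rewrite addr_gt0// !mulr_gt0 ?expR_gt0// addr_gt0// invr_gt0.
near=> L.
(* [16 = 2^4] ensures that the fourth root [r] of [L] is at least 2. *)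
have L16 : (16 <= L)%N by near: L; exact: nbhs_infty_ge.
have L0 : (0 < L)%N by exact: leq_trans L16.
rewrite -expRM mulNr; apply/andP; split; first exact: moment_lower.
set r := L%:R `^ (1 / 4).
have rL : r ^+ 4 = L%:R.
  by rewrite -powR_mulrn ?powR_ge0// -powRrM mul1r mulVf// powRr1.
have r0 : 0 <= r by exact: powR_ge0.
have r2 : 2 <= r.
  rewrite -(@ler_pXn2r _ 4) ?nnegrE//= rL (_ : 2 ^+ 4 = 16%:R :> R) ?ler_nat//.
  by rewrite -natrX.
have -> : Num.sqrt L%:R = r ^+ 2.
  by rewrite -rL (_ : 4 = 2 * 2)%N// exprM sqrtr_sqr ger0_norm// sqr_ge0.
exact: moment_upper.
Unshelve. all: by end_near. Qed.
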